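(* Let $I=(u_1,\ldots,u_q,v)$ be an almost complete intersection monomial ideal of $R=K[x_1,\ldots,x_n]$, and let $s$ be the smallest positive integer such that $v\mid \operatorname{lcm}(u_{j_1},\ldots,u_{j_s})$ for some subset $\{j_1,\ldots,j_s\}\subseteq\{1,\ldots,q\}$ of $s$ elements (it is part of the hypothesis that such a subset exists). Then $\beta_i(R/I)=\binom{q+1}{i}$ for $i=0,1,\ldots,s-1$, and $$\beta_i(R/I)=\binom{q+1}{q+1-i}-\binom{q+1-s}{q+1-i}\quad\text{for } i=s,s+1,\ldots,q.$$
   Context: $K$ is a field and $R=K[x_1,\ldots,x_n]$ is the polynomial ring. For a monomial ideal $I$ of $R$, $G(I)$ denotes its unique minimal set of monomial generators. $I$ is a complete intersection if $\operatorname{height}(I)=|G(I)|$, and an almost complete intersection if $\operatorname{height}(I)=|G(I)|-1$. Convention: writing that $I=(u_1,\ldots,u_q,v)$ is an almost complete intersection monomial ideal means that $G(I)=\{u_1,\ldots,u_q,v\}$ has $q+1$ elements, that $\operatorname{height}(I)=q$, and that $(u_1,\ldots,u_q)$ is a complete intersection monomial ideal. $\beta_i(R/I)$ denotes the $i$-th (total) Betti number, i.e. the rank of the $i$-th free module in the minimal graded free resolution of $R/I$ over $R$. *)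

(* Defs.v *)
From mathcomp Require Import all_boot all_order all_algebra.
From mathcomp.multinomials Require Import mpoly.
From Stdlib Require Import ClassicalEpsilon.

Set Implicit Arguments.
Unset Strict Implicit.
Unset Printing Implicit Defensive.

Import GRing.Theory.
Local Open Scope ring_scope.

(* Ideals given by generators are Prop-valued, since membership need not be
   decidable.  Prime ideals are boolean predicates, as in ring_quotient; under
   excluded_middle_informative (provable in ClassicalEpsilon) every Prop-valued
   predicate is equivalent to a boolean one, so no prime ideal is lost. *)

Section Ideals.
Variables (K : fieldType) (n : nat).
Implicit Types (I : {mpoly K[n]} -> Prop) (P : {pred {mpoly K[n]}}).

Definition ideal_generated (g : seq {mpoly K[n]}) (f : {mpoly K[n]}) : Prop :=
  exists c : 'I_(size g) -> {mpoly K[n]}, f = \sum_i c i * g`_i.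

Definition irrelevant_ideal : {mpoly K[n]} -> Prop :=
  ideal_generated [seq 'X_i | i : 'I_n].

Definition monomial_ideal (g : seq 'X_{1..n}) : {mpoly K[n]} -> Prop :=
  ideal_generated [seq 'X_[m] | m <- g].

(* I is a monomial ideal and G(I) = g. *)
Definition minimal_monomial_generators I (g : seq 'X_{1..n}) : Prop :=
  [/\ uniq g,
      forall f, I f <-> monomial_ideal g f
    & forall h : seq 'X_{1..n}, {subset h <= g} ->
        (forall f, I f <-> monomial_ideal h f) -> {subset g <= h}].

(* idealr_closed includes 1 \notin P. *)
Definition prime_ideal P : Prop := idealr_closed P /\ prime_idealr_closed P.

(* A chain C 0 < C 1 < ... < C k = P of prime ideals. *)
Definition prime_chain (k : nat) (C : nat -> {pred {mpoly K[n]}}) P : Prop :=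
  [/\ forall j, (j <= k)%N -> prime_ideal (C j),
      forall j, (j < k)%N ->
        {subset C j <= C j.+1} /\ ~ {subset C j.+1 <= C j}
    & C k =i P].

Definition prime_height P (h : nat) : Prop :=
  (exists C, prime_chain h C P) /\
  (forall k, (exists C, prime_chain k C P) -> (k <= h)%N).

Definition prime_over I P : Prop :=
  prime_ideal P /\ (forall f, I f -> f \in P).

Definition ideal_height I (h : nat) : Prop :=
  (exists2 P, prime_over I P & prime_height P h) /\
  (forall P k, prime_over I P -> prime_height P k -> (h <= k)%N).

Definition complete_intersection I : Prop :=
  exists2 g, minimal_monomial_generators I g & ideal_height I (size g).

(* I = (u_1, ..., u_q, v) is an almost complete intersection monomial ideal;
   the complete intersection (u_1, ..., u_q) is part of the data. *)
Definition almost_complete_intersection I (q : nat)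
    (u : q.-tuple 'X_{1..n}) (v : 'X_{1..n}) : Prop :=
  [/\ minimal_monomial_generators I (rcons u v),
      ideal_height I q
    & complete_intersection (monomial_ideal u)].

End Ideals.

(* (m <= m')%MM is divisibility of the monomials 'X_[m] and 'X_[m']. *)
Definition divides_lcm_of (n q : nat) (u : q.-tuple 'X_{1..n}) (v : 'X_{1..n})
    (s : nat) : Prop :=
  exists2 J : {set 'I_q}, #|J| = s
    & (v <= \big[@mlcm n/0%MM]_(j in J) tnth u j)%MM.

Definition least_lcm_size (n q : nat) (u : q.-tuple 'X_{1..n}) (v : 'X_{1..n})
    (s : nat) : Prop :=
  [/\ (0 < s)%N, divides_lcm_of u v s
    & forall t, (0 < t)%N -> divides_lcm_of u v t -> (s <= t)%N].

(* A graded resolution  ... -> F_2 -> F_1 -> F_0 -> R/I -> 0  by free modules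
   F_i = \bigoplus_(j < rank i) R(- shift i j).  Elements of F_i are row
   vectors, and diff i : F_(i+1) -> F_i is right multiplication by a matrix.
   The augmentation F_0 -> R/I is given by representatives in R of the images
   of the basis elements, so equality in R/I is congruence modulo I.  All maps
   are homogeneous of degree 0. *)
Record graded_free_resolution (K : fieldType) (n : nat)
    (I : {mpoly K[n]} -> Prop) := GradedFreeResolution {
  res_rank : nat -> nat;
  res_shift : forall i, 'I_(res_rank i) -> int;
  res_diff : forall i, 'M[{mpoly K[n]}]_(res_rank i.+1, res_rank i);
  res_aug : 'cV[{mpoly K[n]}]_(res_rank 0);
  res_diff_homog : forall i j k m, m \in msupp (res_diff i j k) ->
    (mdeg m)%:Z + res_shift k = res_shift j;
  res_aug_homog : forall j m, m \in msupp (res_aug j 0) ->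
    (mdeg m)%:Z = res_shift j;
  res_aug_surj : forall f : {mpoly K[n]},
    exists w : 'rV_(res_rank 0), I (f - (w *m res_aug) 0 0);
  res_exact_aug : forall w : 'rV_(res_rank 0),
    I ((w *m res_aug) 0 0) <-> exists w', w = w' *m res_diff 0;
  res_exact : forall i (w : 'rV_(res_rank i.+1)),
    w *m res_diff i = 0 <-> exists w', w = w' *m res_diff i.+1
}.

(* The image of F_(i+1) lies in (x_1, ..., x_n) F_i. *)
Definition minimal_resolution (K : fieldType) (n : nat)
    (I : {mpoly K[n]} -> Prop) (F : graded_free_resolution I) : Prop :=
  forall i j k, irrelevant_ideal (res_diff F i j k).

(* The i-th total Betti number of R/I, R = K[x_1, ..., x_n].  It is unspecified
   if R/I has no minimal graded free resolution. *)
Definition betti (K : fieldType) (n : nat) (I : {mpoly K[n]} -> Prop)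
    (i : nat) : nat :=
  epsilon (inhabits 0%N) (fun b =>
    exists2 F : graded_free_resolution I, minimal_resolution F
      & res_rank F i = b).

(* Main.v *)
Require Import Defs.
From mathcomp Require Import all_boot all_order all_algebra.
From mathcomp.multinomials Require Import mpoly.
From mathcomp Require Import ring.
From Stdlib Require Import Classical ClassicalEpsilon.

(**
The complete intersection hypothesis says that the [u_j] are pairwise coprime.
Hence a variable dividing [v] divides exactly one of them, and [v] divides the
lcm of a set of [u_j]'s exactly when that set contains the set [J] of those
[u_j] that share a variable with [v]; so [J] is the subset of least size, and
[s = #|J|] ([lcm_support]).

The minimal resolution of [R/I] is the part of the Taylor complex on
[u_1, ..., u_q, v] spanned by the faces that do not contain [J].  (Equivalently:
the mapping cone of multiplication by [v] from [R/((u) : v)] to [R/(u)], with the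
pairs of basis elements that make it non-minimal cancelled.)  As in the criterion
of Bayer, Peeva and Sturmfels, a labelled simplicial complex supports a resolution
as soon as, for every monomial [m] of [I], the faces whose label divides [m] form
a contractible complex ([simplicial_resolution]).  Here they form a cone
([cone_apexP]): if [v] divides [m], the vertex [v] is not in [J] and can be added
to any face; otherwise the generators dividing [m] do not include all of [J], so
every set of them is a face.  The resolution is minimal because adding a vertex to
a face changes its label ([generator_label_neq]).  Any two minimal resolutions have
equal ranks ([minimal_betti]), so [betti I i] is the number of faces with [i]
vertices: all sets of size [i], minus those that contain [J] ([card_faces]).

Coprimality of the [u_j] must be extracted from a statement about heights
([complete_intersection_coprime]).  If [u_j] and [u_k] shared a variable, then [q - 1]
variables would generate a prime containing all the [u_j], and it suffices that a prime
generated by [d] variables has height at most [d] ([variable_prime_chain_le]).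
This is shown by counting.  Along a chain of primes of length [l] that ends there,
choosing one element in each step, one finds [D ^ (l + n - d)] polynomials of
degree [O(D)] that are linearly independent over [K] ([prime_chain_independent]),
while the polynomials of degree [O(D)] in [n] variables form a space of dimension
[O(D ^ n)].  Letting [D] grow gives [l <= d].
*)

Set Implicit Arguments.
Unset Strict Implicit.
Unset Printing Implicit Defensive.

Import GRing.Theory.
Local Open Scope ring_scope.

(** * Monomial ideals *)

Section MonomialIdeals.
Variables (K : fieldType) (n : nat).
Implicit Types (f : {mpoly K[n]}) (m a : 'X_{1..n}) (g h : seq 'X_{1..n}).

Lemma lem_refl a : (a <= a)%MM. Proof. exact/mnm_lepP. Qed.

Lemma lem_trans : transitive (@lem n).
Proof.
move=> b a c /mnm_lepP ab /mnm_lepP bc; apply/mnm_lepP => i.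
exact: leq_trans (ab i) (bc i).
Qed.

Lemma lem_anti a b : (a <= b)%MM -> (b <= a)%MM -> a = b.
Proof.
move=> /mnm_lepP ab /mnm_lepP ba; apply/mnmP => i.
by apply/eqP; rewrite eqn_leq ab ba.
Qed.

Lemma lem_sub2r a b c : (c <= a)%MM -> (c <= b)%MM ->
  (a - c <= b - c)%MM = (a <= b)%MM.
Proof.
move=> /mnm_lepP ca /mnm_lepP cb; apply: eq_forallb => i.
by rewrite !mnmBE leq_sub2rE.
Qed.

Lemma mcoeffMX_le f a m :
  (f * 'X_[a])@_m = if (a <= m)%MM then f@_(m - a) else 0.
Proof.
case: ifPn => [am|nam]; first by rewrite -{1}(submK am) addmC mcoeffMX.
apply/eqP; rewrite mcoeff_eq0; apply: contra nam => /msuppM_le /allpairsP.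
by case=> -[b c] /= [_]; rewrite msuppX inE => /eqP -> ->; apply: lem_addl.
Qed.

Lemma mpoly_of_coeffs (c : 'X_{1..n} -> K) d :
  (forall m, (d <= mdeg m)%N -> c m = 0) ->
  exists f : {mpoly K[n]}, forall m, f@_m = c m.
Proof.
move=> cd; exists (\sum_(m : 'X_{1..n < d}) c m *: 'X_[m]) => m.
have [md|dm] := ltnP (mdeg m) d; first exact: mcoeff_mpoly.
rewrite cd // raddf_sum big1 //= => k _; rewrite mcoeffZ mcoeffX.
by case: eqP => [km|_]; rewrite ?mulr0 //; have := bmdeg k; rewrite km ltnNge dm.
Qed.

Lemma ideal_generated_mem (g : seq {mpoly K[n]}) x c :
  x \in g -> ideal_generated g (c * x).
Proof.
move=> xg; have xi : (index x g < size g)%N by rewrite index_mem.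
exists (fun i => if i == Ordinal xi then c else 0).
rewrite (bigD1 (Ordinal xi)) //= eqxx nth_index // big1 ?addr0 // => i /negbTE ->.
by rewrite mul0r.
Qed.

Lemma ideal_generatedD (g : seq {mpoly K[n]}) x y :
  ideal_generated g x -> ideal_generated g y -> ideal_generated g (x + y).
Proof.
move=> [c ->] [d ->]; exists (fun i => c i + d i).
by rewrite -big_split; apply: eq_bigr => i _; rewrite mulrDl.
Qed.

Lemma ideal_generatedM (g : seq {mpoly K[n]}) c x :
  ideal_generated g x -> ideal_generated g (c * x).
Proof.
move=> [d ->]; exists (fun i => c * d i).
by rewrite mulr_sumr; apply: eq_bigr => i _; rewrite mulrA.
Qed.

Lemma ideal_generated_sum (g : seq {mpoly K[n]}) (T : eqType) (r : seq T) F :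
  {in r, forall t, ideal_generated g (F t)} ->
  ideal_generated g (\sum_(t <- r) F t).
Proof.
move=> Hr; rewrite big_seq; apply: big_ind.
- by exists (fun=> 0); rewrite big1 // => i _; rewrite mul0r.
- exact: ideal_generatedD.
- by move=> t; apply: Hr.
Qed.

(** Every multiple of a monomial generator has only monomials divisible by that
    generator, so membership in a monomial ideal can be read off monomial by
    monomial. *)
Lemma monomial_idealP g f :
  monomial_ideal g f <->
  {in msupp f, forall m, exists2 a, a \in g & (a <= m)%MM}.
Proof.
split=> [[c ->] m /msupp_sum_le /flatten_mapP [i _]|fg].
  rewrite (nth_map 0%MM); last by rewrite -(size_map (fun m => 'X_[K, m])).
  move=> /msuppM_le /allpairsP [[a b] /= [_]].
  rewrite msuppX inE => /eqP -> ->; exists (nth 0%MM g i); last exact: lem_addl.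
  by rewrite mem_nth // -(size_map (fun m => 'X_[K, m])).
rewrite (mpolyE f); apply: ideal_generated_sum => m /fg [a ag am].
rewrite -(submK am) mpolyXD -mul_mpolyC mulrA.
by apply: ideal_generated_mem; apply: map_f.
Qed.

Lemma monomial_idealX g a :
  monomial_ideal g 'X_[K, a] <-> exists2 b, b \in g & (b <= a)%MM.
Proof.
rewrite monomial_idealP; split=> [|H m]; last by rewrite msuppX inE => /eqP ->.
by apply; rewrite msuppX inE.
Qed.

Lemma sub_monomial_ideal g h f :
  {in g, forall a, exists2 b, b \in h & (b <= a)%MM} ->
  monomial_ideal g f -> monomial_ideal h f.
Proof.
move=> gh /monomial_idealP Hf; apply/monomial_idealP => m /Hf [a /gh [b bh ba] am].
by exists b => //; apply: lem_trans am.
Qed.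

Lemma irrelevant_idealP f : irrelevant_ideal f <-> f@_0 = 0.
Proof.
have -> : irrelevant_ideal f <-> monomial_ideal [seq U_(i)%MM | i : 'I_n] f.
  by rewrite /monomial_ideal -map_comp.
rewrite monomial_idealP; split=> [H|f0 m mf].
  apply: memN_msupp_eq0; apply/negP => /H [_ /mapP[i _ ->]].
  by move/mnm_lepP/(_ i); rewrite mnm0E mnm1E eqxx.
have : m != 0%MM by apply: contraTneq mf => ->; rewrite mcoeff_msupp f0 eqxx.
rewrite -mdeg_eq0 mdegE sum_nat_eq0 negb_forall => /existsP [i /= mi].
exists U_(i)%MM; first by apply: map_f; rewrite mem_enum.
by rewrite lep1mP.
Qed.

(** A generator that is a multiple of another one could be removed. *)
Lemma minimal_monomial_generators_antichain (I : {mpoly K[n]} -> Prop) g :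
  minimal_monomial_generators I g -> {in g &, forall a b, (a <= b)%MM -> a = b}.
Proof.
case=> gU Ig gmin a b ag bg ab; apply/eqP/negPn/negP => nab.
suff /(_ b bg) : {subset g <= rem b g} by rewrite mem_rem_uniq // inE eqxx.
apply: gmin => [|f]; first exact/mem_subseq/rem_subseq.
rewrite Ig; split; apply: sub_monomial_ideal => c; last first.
  by rewrite mem_rem_uniq // inE => /andP [_ cg]; exists c => //; apply: lem_refl.
move=> cg; have [->|ncb] := eqVneq c b.
  by exists a; rewrite // mem_rem_uniq // inE nab.
by exists c; [rewrite mem_rem_uniq // inE ncb | apply: lem_refl].
Qed.

End MonomialIdeals.

(** * The height of a prime generated by variables *)

Section Height.
Variables (K : fieldType) (n : nat).
Notation R := {mpoly K[n]}.
Implicit Types (f : R) (C P : {pred R}) (Z : {set 'I_n}).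

Definition independent_mod P (T : finType) (y : T -> R) : Prop :=
  forall c : T -> K, \sum_t c t *: y t \in P -> forall t, c t = 0.

Lemma prime_idealB P f g : prime_ideal P -> f \in P -> g - f \in P -> g \in P.
Proof.
by case=> [[_ _ PD] _] Pf Pgf; rewrite -[g](subrK f) -[g - f]mul1r PD.
Qed.

Lemma prime_idealMl P f g : prime_ideal P -> f \in P -> g * f \in P.
Proof. by case=> [[P0 _ PD] _] Pf; rewrite -[_ * _]addr0 PD. Qed.

(** This is the step that replaces the drop of the transcendence degree along
    [C < C'].  In a relation modulo [C], all terms with a positive power of [f] lie
    in [C'], so the terms with [f ^+ 0] give a relation modulo [C'] and have zero
    coefficients; then [f], which is not in [C], can be divided out of the rest. *)
Lemma independent_powers C C' f (T : finType) (y : T -> R) D :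
  prime_ideal C -> prime_ideal C' -> {subset C <= C'} ->
  f \in C' -> f \notin C -> independent_mod C' y ->
  independent_mod C (fun t : 'I_D * T => f ^+ t.1 * y t.2).
Proof.
move=> pC pC' CC' fC' fC yC'.
have base (c : nat -> T -> K) :
    \sum_(i < D) \sum_t c i t *: (f ^+ i * y t) \in C ->
    forall i t, (i < D)%N -> c i t = 0.
  elim: D c => [|D IH] c; first by [].
  rewrite big_ord_recl /=; set S0 := \sum_t _; set S1 := \sum_(i < D) _.
  have S1E : S1 = f * \sum_(i < D) \sum_t c i.+1 t *: (f ^+ i * y t).
    rewrite mulr_sumr; apply: eq_bigr => i _; rewrite mulr_sumr.
    by apply: eq_bigr => t _; rewrite -scalerAr mulrA -exprS.
  move=> SC.
  have c0 t : c 0%N t = 0.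
    apply: yC' t; have -> : \sum_t c 0%N t *: y t = S0.
      by apply: eq_bigr => t _; rewrite expr0 mul1r.
    apply: (prime_idealB (f := S0 + S1)); [done | exact: CC' |].
    rewrite opprD addNKr S1E mulrC -mulNr; exact: prime_idealMl.
  have S00 : S0 = 0 by apply: big1 => t _; rewrite c0 scale0r.
  move: SC; rewrite S00 add0r S1E.
  case: (pC) => _ /[apply]; rewrite (negbTE fC) /=.
  move=> /(IH (fun i => c i.+1)) c1 [|i] t //.
  exact: (c1 i t).
move=> c cC [i t].
pose c' (j : nat) s := if insub j is Some j' then c (j', s) else 0.
have c'E (j : 'I_D) s : c' j s = c (j, s) by rewrite /c' valK.
rewrite -c'E; apply: base => //.
have -> // : \sum_(i < D) \sum_t c' i t *: (f ^+ i * y t) =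
             \sum_t c t *: (f ^+ t.1 * y t.2).
rewrite pair_big /=; apply: eq_bigr => -[j s] _ /=; by rewrite c'E.
Qed.

Lemma card_bmultinom_le M : (#|{: 'X_{1..n < M}}| <= M ^ n)%N.
Proof.
have lt (m : 'X_{1..n < M}) i : ((m : 'X_{1..n}) i < M)%N.
  by apply: leq_ltn_trans (bmdeg m); rewrite mdegE (bigD1 i) //= leq_addr.
have -> : (M ^ n = #|{ffun 'I_n -> 'I_M}|)%N by rewrite card_ffun !card_ord.
apply: (@leq_card _ _ (fun m => [ffun i => Ordinal (lt m i)])) => m1 m2.
move=> /ffunP e; apply/val_inj/mnmP => i.
by have := congr1 val (e i); rewrite !ffunE.
Qed.

Lemma independent_card P (T : finType) (y : T -> R) M : 0 \in P ->
  independent_mod P y -> (forall t, msize (y t) <= M)%N -> (#|T| <= M ^ n)%N.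
Proof.
move=> P0 yP yM; apply: leq_trans (card_bmultinom_le M).
pose A := \matrix_(i < #|T|, j < #|{: 'X_{1..n < M}}|)
  (y (enum_val i))@_(enum_val j : 'X_{1..n < M}).
suff /eqP <- : row_free A by apply: rank_leq_col.
apply: inj_row_free => w wA; apply/rowP => i; rewrite mxE.
rewrite -[i]enum_valK; apply: (yP (fun t => w 0 (enum_rank t))).
set S := \sum_t _; suff -> : S = 0 by [].
apply/mpolyP => m; rewrite mcoeff0 raddf_sum /=.
have [mM|Mm] := ltnP (mdeg m) M; last first.
  apply: big1 => t _; rewrite mcoeffZ memN_msupp_eq0 ?mulr0 //.
  by apply: msize_mdeg_ge; apply: leq_trans Mm.
have /rowP/(_ (enum_rank (BMultinom mM))) := wA; rewrite !mxE => wA0.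
rewrite -[RHS]wA0.
rewrite (reindex (fun j : 'I_#|T| => enum_val j)) /=; last first.
  exact/onW_bij/enum_val_bij.
by apply: eq_bigr => j _; rewrite mxE !enum_rankK enum_valK mcoeffZ.
Qed.

Lemma msize_expM f g i : (msize (f ^+ i * g) <= i * (msize f).+1 + msize g)%N.
Proof.
elim: i => [|i IH]; first by rewrite expr0 mul1r.
rewrite exprS -mulrA; apply: leq_trans (msizeM_le _ _) _.
by rewrite mulSn -addnA addSn ltnS leq_add2l.
Qed.

(** Iterating [independent_powers] down the chain multiplies the size of a family
    by [D] at each step, while the degrees grow only linearly in [D].  It is
    essential that the constant [E] is chosen before [D]. *)
Lemma prime_chain_independent l (C : nat -> {pred R}) P :
  prime_chain l C P -> exists E, forall D b (T : finType) (y : T -> R),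
  independent_mod (C l) y -> (forall t, msize (y t) <= b)%N ->
  exists (T' : finType) (y' : T' -> R),
    [/\ independent_mod (C 0%N) y', #|T'| = (D ^ l * #|T|)%N
      & forall t, (msize (y' t) <= E * D + b)%N].
Proof.
elim: l P => [|l IH] P [Cp Cs _].
  exists 0%N => D b T y yC yb; exists T, y; split=> //.
  by rewrite expn0 mul1n.
have /IH[E HE] : prime_chain l C (C l).
  by split=> // j lj; [apply: Cp; apply: leqW | apply: Cs; apply: leqW].
have [CC nCC] := Cs l (ltnSn l).
have [f nf] := not_all_ex_not _ _ nCC.
have [fC' /negP fC] := imply_to_and _ _ nf.
exists (E + (msize f).+1)%N => D b T y yC yb.
have pC := Cp l (leqnSn l); have pC' := Cp l.+1 (leqnn _).
have ypow := independent_powers (D := D) pC pC' CC fC' fC yC.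
have /(HE D _ _ _ ypow) [T' [y' [y'C T'E y'b]]] :
    forall t : 'I_D * T, (msize (f ^+ t.1 * y t.2) <= (msize f).+1 * D + b)%N.
  move=> [i t] /=; apply: leq_trans (msize_expM _ _ _) _.
  by rewrite leq_add // mulnC leq_mul // ltnW.
exists T', y'; split=> //; first by rewrite T'E card_prod card_ord mulnA -expnSr.
by move=> t; rewrite mulnDl -addnA.
Qed.

Definition kill_variables Z : R -> R :=
  comp_mpoly [tuple if i \in Z then 0 else 'X_i | i < n].

(** The prime generated by the variables in [Z], as a kernel: it is prime because
    polynomials form a domain. *)
Definition variable_prime Z : {pred R} := [pred f | kill_variables Z f == 0].

Lemma kill_variablesX Z m :
  kill_variables Z 'X_[m] =
  if [forall i in Z, m i == 0%N] then 'X_[m] else 0.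
Proof.
rewrite /kill_variables comp_mpolyX; case: ifPn => [/forall_inP mZ|].
  rewrite mpolyXE_id; apply: eq_bigr => i _; rewrite tnth_mktuple.
  by case: ifP => // /mZ /eqP ->; rewrite !expr0.
rewrite negb_forall_in => /exists_inP[i iZ mi].
by rewrite (bigD1 i) //= tnth_mktuple iZ expr0n (negbTE mi) mul0r.
Qed.

Lemma variable_prime_ideal Z : prime_ideal (variable_prime Z).
Proof.
split; [split|] => [||f g h|f g]; rewrite /variable_prime /kill_variables !inE.
- by rewrite rmorph0.
- by rewrite rmorph1 oner_eq0.
- by move=> /eqP g0 /eqP h0; rewrite rmorphD rmorphM /= g0 h0 mulr0 addr0.
- by rewrite rmorphM mulf_eq0.
Qed.

Lemma variable_prime_over Z (u : seq 'X_{1..n}) :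
  {in u, forall a : 'X_{1..n}, exists2 i, i \in Z & a i != 0%N} ->
  prime_over (monomial_ideal u) (variable_prime Z).
Proof.
move=> uZ; split; first exact: variable_prime_ideal.
move=> f /monomial_idealP fu; rewrite inE (mpolyE f) /kill_variables.
rewrite rmorph_sum /= big_seq big1 // => m /fu [a au /mnm_lepP am].
rewrite linearZ /= -/(kill_variables Z _) kill_variablesX.
have [i iZ ai] := uZ a au; case: ifP => [/forall_inP/(_ i iZ)/eqP mi|].
  by have := am i; rewrite mi leqn0 (negbTE ai).
by rewrite scaler0.
Qed.

(** The family to start from: modulo the prime, [R] is the polynomial ring in the
    variables outside [Z], so the monomials in these variables stay independent. *)
Lemma variable_prime_independent Z D : exists y : _ -> R,
  independent_mod (variable_prime Z)
    (y : {ffun {i | i \in ~: Z} -> 'I_D} -> R)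
  /\ forall t, (msize (y t) <= (n * D).+1)%N.
Proof.
pose mon (t : {ffun {i | i \in ~: Z} -> 'I_D}) : 'X_{1..n} :=
  [multinom if insub i is Some j then t j : nat else 0%N | i < n].
have monP t (j : {i | i \in ~: Z}) : mon t (val j) = t j by rewrite mnmE valK.
have monZ t i : i \in Z -> mon t i = 0%N.
  by move=> iZ; rewrite mnmE insubF // inE iZ.
exists (fun t => 'X_[mon t]); split=> [c|t]; last first.
  rewrite msizeX ltnS mdegE; have -> : (n * D = \sum_(i < n) D)%N.
    by rewrite sum_nat_const card_ord.
  apply: leq_sum => i _; rewrite mnmE; case: insubP => // j _ _.
  exact/ltnW/ltn_ord.
rewrite inE /kill_variables rmorph_sum /= => /eqP S0 t.
have := congr1 (mcoeff (mon t)) S0; rewrite mcoeff0 raddf_sum /= (bigD1 t) //=.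
rewrite big1 => [|s st]; rewrite linearZ /= -/(kill_variables Z _) kill_variablesX.
  case: ifP => [_|/negP[]]; last by apply/forall_inP => i /monZ ->.
  by rewrite mcoeffZ mcoeffX eqxx mulr1 addr0.
case: ifP => _; rewrite mcoeffZ ?mcoeff0 ?mulr0 // mcoeffX.
case: eqP => [e|_]; last by rewrite mulr0.
case/eqP: st; apply/ffunP => j; apply: val_inj; by rewrite /= -!monP e.
Qed.

(** A longer chain would give [D ^ (l + n - #|Z|) >= D ^ n.+1] independent
    polynomials of degree at most [(E + n) * D], more than the dimension of the
    space of such polynomials once [D] is large. *)
Lemma variable_prime_chain_le Z l (C : nat -> {pred R}) :
  prime_chain l C (variable_prime Z) -> (l <= #|Z|)%N.
Proof.
move=> HC; have [E HE] := prime_chain_independent HC; have [Cp _ CP] := HC.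
rewrite leqNgt; apply/negP => lZ.
(* D is the least integer for which D ^ n.+1 exceeds ((E + n.+1) * D) ^ n. *)
pose D := ((E + n.+1) ^ n).+1.
have [y [yi yb]] := variable_prime_independent Z D.
have /(HE D)/(_ yb) [T [z [zi Tc zb]]] : independent_mod (C l) y.
  by move=> c cC; apply: yi; rewrite -CP.
have := independent_card _ zi zb; have [[-> _ _] _] := Cp 0%N isT.
move/(_ isT); rewrite Tc card_ffun card_ord card_sig -expnD.
have -> : #|[pred x | x \in ~: Z]| = (n - #|Z|)%N.
  transitivity #|~: Z|; first exact: eq_card.
  by rewrite cardsCs setCK card_ord.
apply/negP; rewrite -ltnNge.
have leq_expn a b k : (a <= b -> a ^ k <= b ^ k)%N.
  by case: k => // k ab; rewrite leq_exp2r.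
apply: (@leq_ltn_trans (((E + n.+1) * D) ^ n)%N).
  by apply: leq_expn; rewrite mulnDl leq_add2l mulSn addnC -addn1 leq_add2l.
apply: (@leq_trans (D ^ n.+1)%N).
  by rewrite expnMn expnS ltn_mul2r expn_gt0 /= /D ltnS leqnn.
have Zn : (#|Z| <= n)%N by rewrite -[leqRHS](card_ord n) max_card.
have nl : (n < l + (n - #|Z|))%N by rewrite addnBA // ltn_subRL ltn_add2r.
by apply: leq_pexp2l nl.
Qed.

Lemma bounded_max (Q : nat -> Prop) b :
  (exists k, Q k) -> (forall k, Q k -> k <= b)%N ->
  exists2 h, Q h & forall k, Q k -> (k <= h)%N.
Proof.
move=> [k0 Qk0]; elim: b => [|b IH] Qb.
  exists 0%N => //; suff <- : k0 = 0%N by [].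
  by apply/eqP; rewrite -leqn0 Qb.
have [Qb1|nQ] := classic (Q b.+1); first by exists b.+1.
apply: IH => k Qk; have := Qb k Qk.
by rewrite leq_eqVlt => /orP[/eqP kb|//]; case: nQ; rewrite -kb.
Qed.

Lemma variable_prime_height Z :
  exists2 h, prime_height (variable_prime Z) h & (h <= #|Z|)%N.
Proof.
have le k : (exists c, prime_chain k c (variable_prime Z)) -> (k <= #|Z|)%N.
  by case=> c; apply: variable_prime_chain_le.
have [|h Hh hmax] := bounded_max _ le; last by exists h => //; apply: le.
exists 0%N, (fun=> variable_prime Z); split=> // j _.
exact: variable_prime_ideal.
Qed.

(** An element of [g] is divisible by one of [h], which is divisible by one of
    [g]; in an antichain the two elements of [g] coincide. *)
Lemma antichain_generators_sub (g h : seq 'X_{1..n}) :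
  {in g &, forall a b, (a <= b)%MM -> a = b} ->
  (forall f, monomial_ideal g f <-> monomial_ideal h f) -> {subset g <= h}.
Proof.
move=> gA gh a ag.
have /gh/monomial_idealX [b bh ba] : monomial_ideal g ('X_[a] : R).
  by apply/monomial_idealX; exists a => //; apply: lem_refl.
have /gh/monomial_idealX [c cg cb] : monomial_ideal h ('X_[b] : R).
  by apply/monomial_idealX; exists b => //; apply: lem_refl.
have ca : c = a by apply: gA => //; apply: lem_trans ba.
by rewrite (_ : a = b) //; apply: lem_anti ba; rewrite -ca.
Qed.

(** If a variable divided two of the [q] generators, choosing it for both of them
    and any variable of every other generator would give a prime over the ideal
    generated by at most [q - 1] variables, hence of height less than [q]. *)
Lemma complete_intersection_coprime q (u : q.-tuple 'X_{1..n}) :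
  uniq u -> {in u &, forall a b, (a <= b)%MM -> a = b} -> 0%MM \notin u ->
  complete_intersection (@monomial_ideal K n u) ->
  forall j k i, j != k -> tnth u j i != 0%N -> tnth u k i = 0%N.
Proof.
move=> uU uA u0 [g gmin [_ gle]] j k i jk uji; apply/eqP/negPn/negP => uki.
have size_g : size g = q.
  have gA := minimal_monomial_generators_antichain gmin.
  have [gU ug _] := gmin.
  rewrite -(size_tuple u); apply/eqP; rewrite eqn_leq; apply/andP.
  split; apply: uniq_leq_size => //; apply: antichain_generators_sub => // f.
  by split=> /ug.
have var l : exists x, tnth u l x != 0%N.
  have : tnth u l != 0%MM by apply: contraNneq u0 => <-; apply: mem_tnth.
  by rewrite -mdeg_eq0 mdegE sum_nat_eq0 negb_forall => /existsP.
(* Z picks i for both j and k, so it is the image of the indices other than j. *)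
pose x l := if l == k then i else xchoose (var l).
have xP l : tnth u l (x l) != 0%N.
  by rewrite /x; case: (l =P k) => [->|_] //; apply: (xchooseP (var l)).
pose y l := if l == j then i else x l.
pose Z := [set y l | l in [set~ j]].
have Zu : {in u, forall a : 'X_{1..n}, exists2 z, z \in Z & a z != 0%N}.
  move=> _ /tnthP [l ->]; have [->|lj] := eqVneq l j.
    exists i => //; apply/imsetP; exists k; first by rewrite !inE eq_sym.
    by rewrite /y /x eqxx eq_sym (negbTE jk).
  exists (x l) => //; apply/imsetP; exists l; first by rewrite !inE.
  by rewrite /y (negbTE lj).
have [h hP hZ] := variable_prime_height Z.
have := gle _ _ (variable_prime_over Zu) hP; rewrite size_g leqNgt => /negP; apply.
apply: leq_ltn_trans hZ _; apply: leq_ltn_trans (leq_imset_card _ _) _.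
by rewrite cardsC1 card_ord ltn_predL (leq_ltn_trans (leq0n j)).
Qed.

End Height.

(** * Uniqueness of the Betti numbers *)

Section Uniqueness.
Variables (K : fieldType) (n : nat).
Notation R := {mpoly K[n]}.
Variable I : R -> Prop.
Hypothesis I_sum : forall f g, I f -> I g -> I (f + g).
Hypothesis I_mul : forall a f, I f -> I (a * f).
Implicit Types F G : graded_free_resolution I.

(** The exactness conditions speak of one row vector at a time; this collects the
    row-wise solutions into a matrix. *)
Lemma matrix_choice m p (Q : 'I_m -> 'rV[R]_p -> Prop) :
  (forall i, exists w, Q i w) -> exists A, forall i, Q i (row i A).
Proof.
move=> H; pose c i := constructive_indefinite_description _ (H i).
exists (\matrix_(i, j) sval (c i) 0 j) => i.
rewrite (_ : row i _ = sval (c i)); first exact: svalP (c i).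
by apply/rowP => j; rewrite !mxE.
Qed.

Lemma factor_boundary F i m (X : 'M_(m, res_rank F i.+1)) :
  X *m res_diff F i = 0 -> exists Y, X = Y *m res_diff F i.+1.
Proof.
move=> X0; have [j|Y HY] := matrix_choice (m := m)
  (Q := fun j w => row j X = w *m res_diff F i.+1).
  by apply/res_exact; rewrite -row_mul X0 row0.
by exists Y; apply/row_matrixP => j; rewrite HY row_mul.
Qed.

Lemma res_diff_comp F i : res_diff F i.+1 *m res_diff F i = 0.
Proof.
apply/row_matrixP => j; rewrite row_mul row0; apply/res_exact.
by exists (delta_mx 0 j); rewrite -rowE.
Qed.

Lemma factor_augmentation F m (X : 'M_(m, res_rank F 0)) :
  (forall j, I ((X *m res_aug F) j 0)) -> exists Y, X = Y *m res_diff F 0.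
Proof.
move=> X0; have [j|Y HY] := matrix_choice (m := m)
  (Q := fun j w => row j X = w *m res_diff F 0).
  by apply/res_exact_aug; rewrite -row_mul mxE.
by exists Y; apply/row_matrixP => j; rewrite HY row_mul.
Qed.

Lemma res_aug_diff F j : I ((res_diff F 0 *m res_aug F) j 0).
Proof.
have -> : (res_diff F 0 *m res_aug F) j 0 = (row j (res_diff F 0) *m res_aug F) 0 0.
  by rewrite -row_mul [RHS]mxE.
by apply/res_exact_aug; exists (delta_mx 0 j); rewrite -rowE.
Qed.

(** Exactness at [F_0] already forces [I] to contain [0]. *)
Lemma ideal0 F : I 0.
Proof.
have -> : 0 = ((0 : 'rV_(res_rank F 0)) *m res_aug F) 0 0 by rewrite mul0mx mxE.
by apply/res_exact_aug; exists 0; rewrite mul0mx.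
Qed.

Lemma ideal_mulmx F m p (A : 'M_(m, p)) (X : 'cV_p) :
  (forall j, I (X j 0)) -> forall j, I ((A *m X) j 0).
Proof.
move=> XI j; rewrite mxE; apply: big_ind => [|//|k _]; first exact: ideal0 F.
exact: I_mul.
Qed.

Lemma lift_augmentation F G :
  exists A, forall j, I ((res_aug F - A *m res_aug G) j 0).
Proof.
have [j|A HA] := matrix_choice (m := res_rank F 0)
    (Q := fun j w => I (res_aug F j 0 - (w *m res_aug G) 0 0)).
  exact: res_aug_surj.
by exists A => j; have := HA j; rewrite -row_mul !mxE.
Qed.

Notation const_part := (map_mx (mcoeff 0%MM)).

Lemma const_part_diff F i : minimal_resolution F -> const_part (res_diff F i) = 0.
Proof. by move=> Fm; apply/matrixP => j k; rewrite !mxE; apply/irrelevant_idealP. Qed.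

(** The comparison theorem, one degree at a time.  [A] and [B] are the components in
    degree [i] of chain maps [F -> G -> F] that lift the identity of [R/I], and [h] is
    one of a homotopy from their composite to the identity.  The first three
    conditions are what the construction of degree [i.+1] uses; the third one is the
    homotopy identity after composition with [res_diff F i], which removes the
    component of the homotopy in degree [i - 1] and makes the induction
    uniform.  The last condition is the result: by minimality, maps homotopic to the
    identity are the identity modulo the variables. *)
Lemma chain_equivalence F G i : minimal_resolution F ->
  exists (A : 'M_(res_rank F i, res_rank G i)) (B : 'M_(res_rank G i, res_rank F i))
         (h : 'M_(res_rank F i, res_rank F i.+1)),
  [/\ exists A', res_diff F i *m A = A' *m res_diff G i,
      exists B', res_diff G i *m B = B' *m res_diff F i,
      res_diff F i *m (A *m B - 1%:M - h *m res_diff F i) = 0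
    & const_part (A *m B - 1%:M) = 0].
Proof.
move=> Fm; elim: i => [|i [A [B [h [[A' A'E] [B' B'E] hE _]]]]].
  have [A HA] := lift_augmentation F G; have [B HB] := lift_augmentation G F.
  have lift F1 F2 (X : 'M_(res_rank F1 0, res_rank F2 0)) :
      (forall j, I ((res_aug F1 - X *m res_aug F2) j 0)) ->
      exists Y, res_diff F1 0 *m X = Y *m res_diff F2 0.
    move=> HX; apply: factor_augmentation => j.
    have -> : res_diff F1 0 *m X *m res_aug F2 = res_diff F1 0 *m res_aug F1
              + (- res_diff F1 0) *m (res_aug F1 - X *m res_aug F2).
      by rewrite mulmxBr !mulNmx opprK addNKr mulmxA.
    by rewrite mxE; apply: I_sum; [apply: res_aug_diff | apply: (ideal_mulmx F)].
  have [h hE] : exists h, A *m B - 1%:M = h *m res_diff F 0.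
    apply: factor_augmentation => j.
    have -> : (A *m B - 1%:M) *m res_aug F
      = - A *m (res_aug G - B *m res_aug F) + (- 1%:M) *m (res_aug F - A *m res_aug G).
      by rewrite !mulNmx !mulmxBr !mul1mx !opprB mulmxBl mul1mx !mulmxA addrA subrK.
    by rewrite mxE; apply: I_sum; apply: (ideal_mulmx F) => //.
  exists A, B, h; split; rewrite ?hE ?subrr ?mulmx0 //; try exact: lift.
  by rewrite map_mxM const_part_diff // mulmx0.
have [h' h'E] : exists h', A' *m B' - 1%:M - res_diff F i *m h = h' *m res_diff F i.+1.
  apply: factor_boundary; rewrite -hE !mulmxBr !mulmxBl mul1mx mulmx1 -mulmxA -B'E.
  by rewrite !mulmxA A'E.
have ABE : A' *m B' - 1%:M = res_diff F i *m h + h' *m res_diff F i.+1.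
  by rewrite -h'E [RHS]addrC subrK.
exists A', B', h'; split.
- by apply: factor_boundary; rewrite -mulmxA -A'E mulmxA res_diff_comp mul0mx.
- by apply: factor_boundary; rewrite -mulmxA -B'E mulmxA res_diff_comp mul0mx.
- by rewrite ABE addrK mulmxA res_diff_comp mul0mx.
- by rewrite ABE map_mxD !map_mxM !const_part_diff // mul0mx mulmx0 addr0.
Qed.

(** Modulo the variables, the identity of [F_i] factors through [G_i]. *)
Lemma minimal_rank_le F G i : minimal_resolution F ->
  (res_rank F i <= res_rank G i)%N.
Proof.
move=> Fm; have [A [B [h [_ _ _]]]] := chain_equivalence G i Fm.
rewrite map_mxB map_mxM map_mx1 => /eqP; rewrite subr_eq0 => /eqP.
exact: mulmx1_min.
Qed.

Lemma minimal_betti F i : minimal_resolution F -> betti I i = res_rank F i.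
Proof.
move=> Fm; rewrite /betti; set P := (P in epsilon _ P).
have [G Gm <-] : P (epsilon (inhabits 0%N) P).
  by apply: epsilon_spec; exists (res_rank F i), F.
by apply/eqP; rewrite eqn_leq !minimal_rank_le.
Qed.

End Uniqueness.

(** * Chains with coefficients in the field *)

Section SimplicialChains.
Variables (K : fieldType) (N : nat).
Implicit Types (A B : {set 'I_N}) (a b p : 'I_N) (z : {set 'I_N} -> K).

(** The sign with which [A] occurs in the boundary of [a |: A]; membership of [a] in
    [A] does not affect it. *)
Definition orientation a A : K := (-1) ^+ #|[set b in A | (b < a)%N]|.

(** Chains are functions on all subsets of the vertices, including the empty set, so
    that no complex has to be mentioned and the homology is the reduced one. *)
Definition boundary z A : K := \sum_(a | a \notin A) orientation a A * z (a |: A).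

(** Joining with the vertex [p]: the sum of the [z A * A] goes, up to signs, to the
    sum of the [z A * (p |: A)] over the [A] that do not contain [p]. *)
Definition cone p z A : K :=
  if p \in A then orientation p A * z (A :\ p) else 0.

Lemma orientationK a A : orientation a A * orientation a A = 1.
Proof. by rewrite /orientation -expr2 sqrr_sign. Qed.

Lemma orientationU a b A : b \notin A ->
  orientation a (b |: A) = (-1) ^+ (b < a)%N * orientation a A.
Proof.
move=> bA; rewrite /orientation -exprD; congr (_ ^+ _).
have [ba|ab] /= := ltnP b a.
  have -> : [set c in b |: A | (c < a)%N] = b |: [set c in A | (c < a)%N].
    by apply/setP => c; rewrite !inE andb_orl; case: eqP => [->|//]; rewrite ba.
  by rewrite cardsU1 !inE (negbTE bA).
rewrite add0n; apply: eq_card => c; rewrite !inE andb_orl.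
by case: eqP => [->|//]; rewrite ltnNge ab.
Qed.

Lemma sign_ltnC a b : a != b ->
  (-1) ^+ (b < a)%N = - (-1) ^+ (a < b)%N :> K.
Proof.
by move=> ab; rewrite ltn_neqAle leqNgt eq_sym (inj_eq val_inj) ab /= signrN.
Qed.

(** The two orders in which two vertices can be added to [A] have opposite signs. *)
Lemma boundary_boundary z A : boundary (boundary z) A = 0.
Proof.
pose F a b := orientation a A * orientation b (a |: A) * z (b |: (a |: A)).
have -> : boundary (boundary z) A =
    \sum_(a | a \notin A) \sum_(b | (b \notin A) && (a != b)) F a b.
  apply: eq_bigr => a aA; rewrite mulr_sumr.
  by apply: eq_big => [b|b _]; rewrite ?mulrA // in_setU1 negb_or andbC eq_sym.
have -> : \sum_(a | a \notin A) \sum_(b | (b \notin A) && (a != b)) F a b =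
    \sum_(a | a \notin A) \sum_(b | (b \notin A) && (a < b)%N) F a b +
    \sum_(a | a \notin A) \sum_(b | (b \notin A) && (b < a)%N) F a b.
  rewrite -big_split /=; apply: eq_bigr => a aA.
  rewrite (bigID (fun b : 'I_N => (a < b)%N)) /=; congr (_ + _);
    apply: eq_bigl => b; rewrite -andbA -val_eqE; case: ltngtP; rewrite ?andbF //=.
rewrite [X in _ + X](exchange_big_dep (fun b => b \notin A)) /=; last first.
  by move=> a b _ /andP[].
rewrite -big_split big1 //= => a aA.
rewrite [X in _ + X](eq_bigl (fun b => (b \notin A) && (a < b)%N)); last first.
  by move=> b; rewrite aA.
rewrite -big_split big1 //= => b /andP[bA ab].
have nab : a != b by rewrite -val_eqE neq_ltn ab.
rewrite /F !orientationU // (sign_ltnC nab) (setUCA [set b]); ring.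
Qed.

(** The cone is a contracting homotopy, so a cycle is the boundary of its cone. *)
Lemma boundary_cone p z A : boundary (cone p z) A + cone p (boundary z) A = z A.
Proof.
rewrite {2}/cone; case: ifPn => [pA|pA]; last first.
  rewrite addr0 /boundary (bigD1 p) //= big1 => [|b /andP[bA bp]].
    rewrite addr0 /cone setU11 setU1K // orientationU // ltnn mul1r.
    by rewrite mulrA orientationK mul1r.
  by rewrite /cone in_setU1 eq_sym (negbTE bp) (negbTE pA) mulr0.
have pAp : p \notin A :\ p by rewrite !inE eqxx.
have Ap := setD1K pA.
rewrite {2}/boundary mulr_sumr (bigD1 p) //= Ap.
have sgp : orientation p (A :\ p) = orientation p A.
  by rewrite -{2}Ap orientationU // ltnn mul1r.
rewrite sgp mulrA orientationK mul1r addrCA -[RHS]addr0; congr (_ + _).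
rewrite [X in _ + X](eq_bigl (fun b => b \notin A)) => [|b]; last first.
  by rewrite !inE; case: eqP => [->|]; rewrite ?pA ?andbF ?andbT.
rewrite -big_split big1 //= => b bA.
have bp : p != b by apply: contraNneq bA => <-.
have bAp : b \notin A :\ p by rewrite !inE (negbTE bA) andbF.
rewrite /cone in_setU1 pA orbT.
have -> : (b |: A) :\ p = b |: (A :\ p).
  by apply/setP => c; rewrite !inE; case: (c =P b) => [->|//]; rewrite eq_sym bp.
have -> : orientation p (b |: A) = orientation p (b |: (A :\ p)).
  rewrite -{1}Ap setUCA [LHS]orientationU ?ltnn ?mul1r //.
  by rewrite in_setU1 (negbTE bp) (negbTE pAp).
rewrite -sgp -{1}Ap !orientationU // (sign_ltnC bp).
have sgn2 : (-1) ^+ (p < b)%N * (-1) ^+ (p < b)%N = 1 :> K.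
  by rewrite -expr2 sqrr_sign.
ring: sgn2.
Qed.

End SimplicialChains.

(** * The resolution supported on a simplicial complex *)

Section SimplicialResolution.
Variables (K : fieldType) (n N : nat) (g : 'I_N -> 'X_{1..n}).
Notation R := {mpoly K[n]}.
Implicit Types (m : 'X_{1..n}) (A B : {set 'I_N}) (a b p : 'I_N).
Implicit Types (w : {set 'I_N} -> R).

Definition label A : 'X_{1..n} := \big[@mlcm n/0%MM]_(a in A) g a.

Lemma label_le A m : (label A <= m)%MM = [forall a in A, (g a <= m)%MM].
Proof.
rewrite /label -big_andE.
rewrite (big_morph (fun x : 'X_{1..n} => (x <= m)%MM) (lem_mlcm m) (id1 := true)) //.
by apply/mnm_lepP => i; rewrite mnm0E.
Qed.

Lemma label_mem A a m : a \in A -> (label A <= m)%MM -> (g a <= m)%MM.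
Proof. by move=> aA; rewrite label_le => /forall_inP/(_ a aA). Qed.

Lemma sub_label A B : A \subset B -> (label A <= label B)%MM.
Proof.
move=> /subsetP AB; rewrite label_le; apply/forall_inP => a /AB aB.
exact: label_mem aB (lem_refl _).
Qed.

Lemma label_leU a A m : (label (a |: A) <= m)%MM = (g a <= m)%MM && (label A <= m)%MM.
Proof.
apply/idP/andP => [H|[ga]]; first split; first exact: label_mem (setU11 a A) H.
  by apply: lem_trans H; apply/sub_label/subsetUr.
rewrite !label_le => /forall_inP H; apply/forall_inP => b.
by rewrite in_setU1 => /predU1P[->|/H].
Qed.

Lemma label_coord A (c : nat) (x : 'I_n) :
  (0 < c)%N -> (c <= label A x)%N -> exists2 a, a \in A & (c <= g a x)%N.
Proof.
move=> c0 cA; apply/exists_inP; apply: contraLR cA.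
rewrite negb_exists_in => /forall_inP H; rewrite -ltnNge -(prednK c0) ltnS.
rewrite /label (big_morph (fun m : 'X_{1..n} => m x) (id1 := 0%N) (op1 := maxn)).
- by apply/bigmax_leqP => a /H; rewrite -ltnNge -{1}(prednK c0).
- by move=> a b; rewrite mnmE.
- exact: mnm0E.
Qed.

(** The component of [w] of multidegree [m], where the basis element of the face
    [A] has multidegree [label A].  Forgetting the monomials turns it into a chain
    with coefficients in [K]. *)
Definition strand m w A : K :=
  if (label A <= m)%MM then (w A)@_(m - label A) else 0.

Lemma strand_inj w1 w2 A :
  (forall m, strand m w1 A = strand m w2 A) -> w1 A = w2 A.
Proof.
move=> H; apply/mpolyP => m; have := H (m + label A)%MM.
by rewrite /strand lem_addl addmK.
Qed.

Definition simplicial_boundary w A : R :=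
  \sum_(a | a \notin A)
    orientation K a A *: (w (a |: A) * 'X_[label (a |: A) - label A]).

(** In each multidegree the boundary with monomial coefficients is the ordinary
    boundary of the simplicial complex of the faces whose label divides [m]. *)
Lemma strand_boundary m w A :
  strand m (simplicial_boundary w) A = boundary (strand m w) A.
Proof.
rewrite {1}/strand; case: ifPn => [Am|nAm]; last first.
  rewrite /boundary big1 // => a _; rewrite /strand label_leU (negbTE nAm).
  by rewrite andbF mulr0.
rewrite raddf_sum; apply: eq_bigr => a aA /=; rewrite mcoeffZ mcoeffMX_le /strand.
rewrite lem_sub2r ?sub_label ?subsetUr //; case: ifP => // _; congr (_ * _@__).
apply/mnmP => i; rewrite !mnmBE.
have /mnm_lepP/(_ i) := Am; have /mnm_lepP/(_ i) := sub_label (subsetUr [set a] A).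
by move=> h1 h2; rewrite subnBA ?subnK.
Qed.

Lemma simplicial_boundaryK w A : simplicial_boundary (simplicial_boundary w) A = 0.
Proof.
rewrite -[RHS]/((fun=> 0) A); apply: strand_inj => m.
rewrite strand_boundary /boundary.
rewrite (eq_bigr (fun a => orientation K a A * boundary (strand m w) (a |: A))).
  by rewrite -/(boundary _ A) boundary_boundary /strand mcoeff0 if_same.
by move=> a _; rewrite strand_boundary.
Qed.

Variables (Delta : {set {set 'I_N}}) (apex : 'X_{1..n} -> 'I_N).
Hypothesis Delta0 : set0 \in Delta.
Hypothesis Delta_sub : forall A B, A \subset B -> B \in Delta -> A \in Delta.
Hypothesis apexP : forall m b, (g b <= m)%MM ->
  (g (apex m) <= m)%MM /\
  forall A, A \in Delta -> (label A <= m)%MM -> apex m |: A \in Delta.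

Definition faces i : {set {set 'I_N}} := [set A in Delta | #|A| == i].

(** Elements of the free module on the faces with [i] vertices are handled as
    functions on all sets of vertices, which avoids transport between the index
    types of the matrices. *)
Definition chain i w : Prop := forall A, A \notin faces i -> w A = 0.

(** The cone is taken in each multidegree [m] separately, with the apex of [m].  The
    condition on [w set0] covers the augmentation: the empty face is the only
    one whose label can divide a monomial outside of the ideal, and there no
    apex is available. *)
Lemma simplicial_exact i w : chain i w -> (forall A, simplicial_boundary w A = 0) ->
  {in msupp (w set0), forall m, exists b, (g b <= m)%MM} ->
  exists2 w', chain i.+1 w' & forall A, simplicial_boundary w' A = w A.
Proof.
move=> wi dw w0.
have wm m A : strand m w A != 0 ->
    [/\ A \in faces i, (label A <= m)%MM & exists b, (g b <= m)%MM].
  rewrite /strand; case: ifP => [Am wA|_]; last by rewrite eqxx.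
  split=> //; first by apply: contraNT wA => /wi ->; rewrite mcoeff0.
  have [A0|[b bA]] := set_0Vmem A; last by exists b; apply: label_mem bA Am.
  have [|b gb] := w0 (m - label A)%MM; first by rewrite -A0 mcoeff_msupp.
  by exists b; apply: lem_trans gb (lem_subr _ _).
(* The monomial k in the coefficient of B has multidegree k + label B. *)
pose c B k := let m := (k + label B)%MM in cone (apex m) (strand m w) B.
have cP B k : c B k != 0 -> let A := B :\ apex (k + label B)%MM in
    B \in faces i.+1 /\ strand (k + label B) w A != 0.
  rewrite /c /cone; set m := (k + _)%MM; case: ifP => [pB|_]; last by rewrite eqxx.
  rewrite mulf_eq0 negb_or => /andP[_ wA]; split=> //.
  have [] := wm _ _ wA; rewrite !inE => /andP[AD Ai] Am [b gb].
  have [_ /(_ _ AD Am)] := apexP gb; rewrite setD1K // => ->.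
  by rewrite (cardsD1 (apex m)) pB (eqP Ai) /=.
have [w' w'E] : exists w', forall B k, (w' B)@_k = c B k.
  suff H B : exists f : R, forall k, f@_k = c B k.
    exists (fun B => sval (constructive_indefinite_description _ (H B))) => B.
    exact: svalP (constructive_indefinite_description _ (H B)).
  apply: (mpoly_of_coeffs (d := \max_A msize (w A))) => k kd.
  apply/eqP/negPn/negP => /cP [_]; set A := B :\ _; rewrite /strand.
  case: ifP => [_|_]; last by rewrite eqxx.
  rewrite -mcoeff_msupp => /msize_mdeg_lt; rewrite ltnNge => /negP; apply.
  apply: leq_trans (leq_bigmax (F := fun A => msize (w A)) A) _; apply: leq_trans kd _.
  rewrite !mdegE; apply: leq_sum => j _; rewrite mnmBE mnmDE.
  have /mnm_lepP/(_ j) := sub_label (subsetDl B [set apex (k + label B)%MM]).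
  by move=> h; rewrite -addnBA ?leq_addr.
exists w' => [B BF|A].
  apply/mpolyP => k; rewrite w'E mcoeff0; apply/eqP.
  by apply: contraNT BF => /cP [].
apply: strand_inj => m; rewrite strand_boundary -[RHS](boundary_cone (apex m)).
have -> : cone (apex m) (boundary (strand m w)) A = 0.
  rewrite /cone; case: ifP => // _; rewrite -strand_boundary /strand dw mcoeff0.
  by rewrite if_same mulr0.
rewrite addr0; apply: eq_bigr => a _; congr (_ * _); move: (a |: A) => B.
rewrite /strand w'E /c; case: ifPn => [Bm|nBm]; first by rewrite submK.
rewrite /cone; case: ifP => // pB; apply/esym/eqP; rewrite mulf_eq0; apply/orP.
right; apply: contraNT nBm => /wm [_ Am [b /apexP [gp _]]].
by rewrite -(setD1K pB) label_leU gp.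
Qed.

Lemma chain_boundary i w : chain i.+1 w -> chain i (simplicial_boundary w).
Proof.
move=> wi A AF; rewrite /simplicial_boundary big1 // => a aA.
rewrite wi ?mul0r ?scaler0 //.
apply: contra AF; rewrite !inE cardsU1 aA eqSS => /andP[aAD ->]; rewrite andbT.
exact: Delta_sub (subsetUr _ _) aAD.
Qed.

Definition vect i w : 'rV[R]_#|faces i| := \row_j w (enum_val j).

Definition incidence B A : R := \sum_(a | (a \notin A) && (a |: A == B))
  orientation K a A *: 'X_[label B - label A].

Definition simplicial_diff i : 'M[R]_(#|faces i.+1|, #|faces i|) :=
  \matrix_(j, k) incidence (enum_val j) (enum_val k).

Lemma vectP i (x : 'rV_#|faces i|) : exists2 w, chain i w & x = vect i w.
Proof.
exists (fun A => \sum_j (x 0 j) *+ (enum_val j == A)) => [A AF|].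
  rewrite big1 // => j _; case: eqP => // jA.
  by move: AF; rewrite -jA enum_valP.
apply/rowP => j; rewrite mxE (bigD1 j) //= eqxx big1 ?addr0 // => k kj.
by rewrite (inj_eq enum_val_inj) (negbTE kj).
Qed.

Lemma sum_faces i w (F : {set 'I_N} -> R) : chain i w ->
  \sum_(j < #|faces i|) w (enum_val j) * F (enum_val j) = \sum_A w A * F A.
Proof.
move=> wi; rewrite -(big_enum_val (fun A => w A * F A)) big_mkcond /=.
by apply: eq_bigr => A _; case: ifPn => // /wi ->; rewrite mul0r.
Qed.

Lemma vect_boundary i w : chain i.+1 w ->
  vect i.+1 w *m simplicial_diff i = vect i (simplicial_boundary w).
Proof.
move=> wi; apply/rowP => k; rewrite !mxE; set A := enum_val k.
transitivity (\sum_B w B * incidence B A).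
  by rewrite -(sum_faces _ wi); apply: eq_bigr => j _; rewrite !mxE.
rewrite /incidence; under eq_bigr do rewrite mulr_sumr.
rewrite (exchange_big_dep (fun a => a \notin A)) /=; last by move=> B a _ /andP[].
apply: eq_bigr => a aA; rewrite (big_pred1 (a |: A)) => [|B]; last first.
  by rewrite aA eq_sym.
by rewrite scalerAr.
Qed.

Lemma vect_inj i w1 w2 : chain i w1 -> chain i w2 -> vect i w1 = vect i w2 ->
  forall A, w1 A = w2 A.
Proof.
move=> h1 h2 /rowP e A; have [AF|AF] := boolP (A \in faces i); last by rewrite h1 ?h2.
by have := e (enum_rank_in AF A); rewrite !mxE enum_rankK_in.
Qed.

Lemma eq_vect i w1 w2 : w1 =1 w2 -> vect i w1 = vect i w2.
Proof. by move=> e; apply/rowP => j; rewrite !mxE e. Qed.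

Variable I : R -> Prop.
Hypothesis IP : forall f, I f <-> {in msupp f, forall m, exists b, (g b <= m)%MM}.

Lemma faces0 A : (A \in faces 0) = (A == set0).
Proof. by rewrite inE cards_eq0 andbC; case: eqP => // ->; rewrite Delta0. Qed.

Definition simplicial_aug : 'cV[R]_#|faces 0| := const_mx 1.

Lemma vect_aug w : (vect 0 w *m simplicial_aug) 0 0 = w set0.
Proof.
rewrite mxE (eq_bigr (fun j => w (enum_val j))) => [|j _]; last first.
  by rewrite !mxE mulr1.
rewrite -big_enum_val (big_pred1 set0) // => A; exact: faces0.
Qed.

Lemma simplicial_diff_homog i j k m : m \in msupp (simplicial_diff i j k) ->
  (mdeg m)%:Z + (mdeg (label (enum_val k)))%:Z = (mdeg (label (enum_val j)))%:Z.
Proof.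
rewrite mxE => /msupp_sum_le /flatten_mapP [a].
rewrite mem_filter => /andP[/andP[_ /eqP <-] _] /msuppZ_le.
rewrite msuppX inE => /eqP ->.
by rewrite -PoszD -mdegD submK // sub_label ?subsetUr.
Qed.

Lemma simplicial_aug_homog j m : m \in msupp (simplicial_aug j 0) ->
  (mdeg m)%:Z = (mdeg (label (enum_val j)))%:Z.
Proof.
rewrite mxE msupp1 inE => /eqP ->.
by have := enum_valP j; rewrite faces0 => /eqP ->; rewrite /label big_set0.
Qed.

Lemma simplicial_aug_surj f :
  exists x : 'rV_#|faces 0|, I (f - (x *m simplicial_aug) 0 0).
Proof.
exists (vect 0 (fun=> f)); rewrite vect_aug subrr.
by apply/IP => m; rewrite msupp0.
Qed.

Lemma simplicial_exact_aug (x : 'rV_#|faces 0|) :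
  I ((x *m simplicial_aug) 0 0) <-> exists x', x = x' *m simplicial_diff 0.
Proof.
split.
  have [w w0 ->] := vectP x; rewrite vect_aug => /IP Iw.
  have [A|w' w'1 w'E] := simplicial_exact w0 _ Iw.
    rewrite /simplicial_boundary big1 // => a aA; rewrite w0 ?mul0r ?scaler0 //.
    by rewrite faces0 -card_gt0 cardsU1 aA.
  by exists (vect 1 w'); rewrite vect_boundary //; apply: eq_vect => A.
case=> x' ->; have [w w1 ->] := vectP x'; rewrite vect_boundary // vect_aug.
apply/IP => m /msupp_sum_le /flatten_mapP [a _] /msuppZ_le /msuppM_le /allpairsP.
case=> -[b c] /= [_]; rewrite msuppX inE => /eqP -> ->; exists a.
rewrite setU0 /label big_set1E mlcm0 big_set0 subm0; exact: lem_addl.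
Qed.

Lemma simplicial_exact_mx i (x : 'rV_#|faces i.+1|) :
  x *m simplicial_diff i = 0 <-> exists x', x = x' *m simplicial_diff i.+1.
Proof.
split.
  have [w wi ->] := vectP x; rewrite vect_boundary // => dw.
  have dw0 A : simplicial_boundary w A = 0.
    apply: (@vect_inj i _ (fun=> 0)) => //; first exact: chain_boundary.
    by rewrite dw; apply/rowP => j; rewrite !mxE.
  have w0 : w set0 = 0 by apply: wi; rewrite inE cards0 andbF.
  have [|w' w'i w'E] := simplicial_exact wi dw0 _.
    by rewrite w0 => m; rewrite msupp0.
  by exists (vect i.+2 w'); rewrite vect_boundary //; apply: eq_vect => A.
case=> x' ->; have [w wi ->] := vectP x'.
rewrite !vect_boundary //; last exact: chain_boundary.
by apply/rowP => j; rewrite !mxE simplicial_boundaryK.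
Qed.

Definition simplicial_resolution : graded_free_resolution I :=
  GradedFreeResolution (res_shift := fun i j => (mdeg (label (enum_val j)))%:Z)
    simplicial_diff_homog simplicial_aug_homog simplicial_aug_surj
    simplicial_exact_aug simplicial_exact_mx.

(** An entry of the differential is, up to sign, the quotient of two labels, and it is a
    unit exactly when they are equal. *)
Lemma simplicial_minimal :
  (forall a A, a \notin A -> a |: A \in Delta -> label (a |: A) != label A) ->
  minimal_resolution simplicial_resolution.
Proof.
move=> lab i j k; apply/irrelevant_idealP; rewrite mxE raddf_sum big1 //= => a.
move=> /andP[aA /eqP aAE]; rewrite mcoeffZ mcoeffX.
case: eqP => [e|]; last by rewrite mulr0.
have aAD : a |: enum_val k \in Delta.
  by rewrite aAE; have := enum_valP j; rewrite inE => /andP[].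
have /eqP[] := lab a _ aA aAD; rewrite aAE.
have := sub_label (subsetUr [set a] (enum_val k)); rewrite aAE.
by move/submK; rewrite e add0m => ->.
Qed.

End SimplicialResolution.

(** * Almost complete intersections *)

Section AlmostCompleteIntersections.
Variables (K : fieldType) (n q : nat) (u : q.-tuple 'X_{1..n}) (v : 'X_{1..n}).
Variable s : nat.
Hypothesis gens_uniq : uniq (rcons u v).
Hypothesis gens_antichain : {in rcons u v &, forall a b, (a <= b)%MM -> a = b}.
Hypothesis coprime_u : forall j k x,
  j != k -> tnth u j x != 0%N -> tnth u k x = 0%N.
Variable J : {set 'I_q}.
Hypothesis J_s : #|J| = s.
Hypothesis s_gt0 : (0 < s)%N.
Hypothesis J_lcm : (v <= label (tnth u) J)%MM.
Hypothesis s_least : forall t, (0 < t)%N -> divides_lcm_of u v t -> (s <= t)%N.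

Lemma u_neq_v j : tnth u j != v.
Proof.
move: gens_uniq; rewrite rcons_uniq => /andP[vu _].
by apply: contraNneq vu => <-; apply: mem_tnth.
Qed.

Lemma u_not_dvd_v j : ~~ (tnth u j <= v)%MM.
Proof.
apply/negP => /gens_antichain uv; have /eqP[] := u_neq_v j.
by apply: uv; rewrite mem_rcons inE ?eqxx // mem_tnth orbT.
Qed.

Lemma v_not_dvd_u j : ~~ (v <= tnth u j)%MM.
Proof.
apply/negP => /gens_antichain vu; have /eqP[] := u_neq_v j.
by apply/esym/vu; rewrite mem_rcons inE ?eqxx // mem_tnth orbT.
Qed.

(** Since a variable of [v] divides only one [u_j], the set [J :&: A] still has an lcm
    divisible by [v]; by minimality of [s] it cannot be smaller than [J]. *)
Lemma lcm_support (A : {set 'I_q}) : (v <= label (tnth u) A)%MM -> J \subset A.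
Proof.
move=> /mnm_lepP vA.
have vJA : (v <= label (tnth u) (J :&: A))%MM.
  apply/mnm_lepP => x; have [->//|v0] := posnP (v x).
  have [j jJ vj] := label_coord v0 (mnm_lepP J_lcm x).
  have [k kA vk] := label_coord v0 (vA x).
  have jk : j = k.
    apply/eqP; apply: contraTT vk => /coprime_u ->; last first.
      by rewrite -lt0n (leq_trans v0).
    by rewrite -ltnNge.
  apply: leq_trans vj _; move: x {v0 vk}; apply/mnm_lepP.
  by apply: label_mem (lem_refl _); rewrite inE jJ jk.
have : (0 < #|J :&: A|)%N.
  rewrite lt0n cards_eq0; apply: contraTneq s_gt0 => JA0.
  move: vJA; rewrite JA0 /label big_set0 => v0.
  rewrite -J_s -leqNgt leqn0 cards_eq0; apply/eqP/setP => j; rewrite inE.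
  case/negP: (v_not_dvd_u j); apply: lem_trans v0 _.
  by apply/mnm_lepP => x; rewrite mnm0E.
move/s_least => /(_ (ex_intro2 _ _ (J :&: A) erefl vJA)); rewrite -J_s => le.
by apply/setIidPl/eqP; rewrite eqEcard subsetIl.
Qed.

Definition generator (i : 'I_q.+1) : 'X_{1..n} :=
  if unlift ord_max i is Some j then tnth u j else v.

Lemma generator_max : generator ord_max = v.
Proof. by rewrite /generator unlift_none. Qed.

Lemma generator_lift j : generator (lift ord_max j) = tnth u j.
Proof. by rewrite /generator liftK. Qed.

Lemma generator_mem a : a \in rcons u v <-> exists i, a = generator i.
Proof.
rewrite mem_rcons inE; split=> [/predU1P[->|/tnthP[j ->]]|[i ->]].
- by exists ord_max; rewrite generator_max.
- by exists (lift ord_max j); rewrite generator_lift.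
- by case: (unliftP ord_max i) => [j|] ->;
    rewrite ?generator_max ?eqxx // generator_lift mem_tnth orbT.
Qed.

Definition bad_face : {set 'I_q.+1} := [set lift ord_max j | j in J].

(** The join of the boundary of the simplex on [J] with the full simplex on the
    remaining vertices, among them the one of [v]. *)
Definition join_complex : {set {set 'I_q.+1}} :=
  [set A : {set 'I_q.+1} | ~~ (bad_face \subset A)].

Lemma card_bad_face : #|bad_face| = s.
Proof. by rewrite card_imset //; apply: lift_inj. Qed.

Lemma join_complex0 : set0 \in join_complex.
Proof. by rewrite inE subset0 -cards_eq0 card_bad_face -lt0n. Qed.

Lemma join_complex_sub (A B : {set 'I_q.+1}) :
  A \subset B -> B \in join_complex -> A \in join_complex.
Proof. by move=> AB; rewrite !inE; apply: contra => /subset_trans; apply. Qed.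

Definition cone_apex m : 'I_q.+1 :=
  if (v <= m)%MM then ord_max else odflt ord_max [pick b | (generator b <= m)%MM].

(** If [v] does not divide [m], then by [J_lcm] the generators that divide [m] do not
    include all of [J], so any set of them is a face and each of them is an
    apex. *)
Lemma cone_apexP m b : (generator b <= m)%MM ->
  (generator (cone_apex m) <= m)%MM /\
  forall A, A \in join_complex -> (label generator A <= m)%MM ->
    cone_apex m |: A \in join_complex.
Proof.
rewrite /cone_apex => bm; case: ifPn => [vm|nvm].
  split=> [|A AD _]; first by rewrite generator_max.
  rewrite !inE in AD *; apply: contra AD => /subsetP SA.
  apply/subsetP => c cS; have := SA c cS; rewrite in_setU1 => /predU1P[cm|//].
  case/imsetP: cS => j _ cj; case/eqP: (neq_lift ord_max j); by rewrite -cj -cm.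
case: pickP => [p /= pm|/(_ b)]; last by rewrite bm.
split=> // A _ Am; rewrite inE; apply: contra nvm => /subsetP SA.
apply: lem_trans J_lcm _; rewrite label_le; apply/forall_inP => j jJ.
rewrite -generator_lift; have /SA : lift ord_max j \in bad_face by apply: imset_f.
by rewrite in_setU1 => /predU1P[->|/label_mem]; last exact.
Qed.

(** Adding [v] changes the label because a face does not contain [J].  Adding
    [u_j] changes it because some variable has a larger exponent in [u_j] than in
    [v], and by coprimality that variable divides no other [u_k]. *)
Lemma generator_label_neq a (A : {set 'I_q.+1}) :
  a \notin A -> a |: A \in join_complex ->
  label generator (a |: A) != label generator A.
Proof.
move=> aA; apply: contraTneq => labE; rewrite inE negbK.
have : (generator a <= label generator A)%MM.
  by rewrite -labE; apply: label_mem (lem_refl _); apply: setU11.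
case: (unliftP ord_max a) aA => [j|] -> aA.
  rewrite generator_lift => ujA; have := u_not_dvd_v j.
  rewrite negb_forall => /existsP[x]; rewrite -ltnNge => vux.
  (* m bounds the label of A without u_j: at x only v can contribute. *)
  pose m := [multinom if i == x then v x else label generator A i | i < n].
  suff /mnm_lepP/(_ x) Ax : (label generator A <= m)%MM.
    have := leq_trans (mnm_lepP ujA x) Ax; by rewrite mnmE eqxx leqNgt vux.
  rewrite label_le; apply/forall_inP => b bA; apply/mnm_lepP => i; rewrite mnmE.
  case: eqP => [->|_]; last by move: i; apply/mnm_lepP; apply: label_mem (lem_refl _).
  case: (unliftP ord_max b) bA => [k|] -> bA; last by rewrite generator_max.
  rewrite generator_lift (@coprime_u j k) //; last first.
    by rewrite -lt0n (leq_ltn_trans _ vux).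
  by apply: contraNneq aA => ->.
rewrite generator_max => vA.
pose A' := [set j | lift ord_max j \in A].
have /subsetP JA' : J \subset A'.
  apply: lcm_support; apply: lem_trans vA _; rewrite label_le.
  apply/forall_inP => b bA; case: (unliftP ord_max b) bA aA => [k|] -> bA aA.
    by rewrite generator_lift; apply: label_mem (lem_refl _); rewrite inE.
  by rewrite bA in aA.
apply/subsetP => _ /imsetP[j /JA' jA ->]; rewrite in_setU1; apply/orP; right.
by rewrite inE in jA.
Qed.

(** Complements of the supersets are the subsets of the complement, of size
    [q.+1 - i]. *)
Lemma card_supersets i : (i <= q.+1)%N ->
  #|[set A : {set 'I_q.+1} | (bad_face \subset A) && (#|A| == i)]|
  = 'C(q.+1 - s, q.+1 - i).
Proof.
move=> iq; have -> : (q.+1 - s)%N = #|~: bad_face|.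
  by rewrite [RHS]cardsCs setCK card_ord card_bad_face.
rewrite -cards_draws -(card_imset _ (@setC_inj _)); apply: eq_card => A.
rewrite -[A]setCK (mem_imset _ _ (@setC_inj _)) !inE setCK subsetC; congr (_ && _).
have cA : (#|A| <= q.+1)%N by rewrite -[leqRHS](card_ord q.+1) max_card.
have -> : #|~: A| = (q.+1 - #|A|)%N by rewrite cardsCs setCK card_ord.
by apply/eqP/eqP => [<-|->]; rewrite subKn.
Qed.

Lemma card_faces i : (i <= q.+1)%N ->
  #|faces join_complex i| = ('C(q.+1, i) - 'C(q.+1 - s, q.+1 - i))%N.
Proof.
move=> iq; rewrite -card_supersets // -[in 'C(_, i)](card_ord q.+1) -card_draws.
have -> : faces join_complex i = [set A : {set 'I_q.+1} | #|A| == i] :\: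
    [set A : {set 'I_q.+1} | (bad_face \subset A) && (#|A| == i)].
  by apply/setP => A; rewrite !inE; case: (_ == i); rewrite ?andbF ?andbT.
rewrite cardsD; congr (_ - _)%N; apply: eq_card => A; rewrite !inE andbC.
by case: (_ == i); rewrite ?andbF ?andbT.
Qed.

End AlmostCompleteIntersections.

Theorem theorem1p14 (K : fieldType) (n q : nat) (I : {mpoly K[n]} -> Prop)
    (u : q.-tuple 'X_{1..n}) (v : 'X_{1..n}) (s : nat) :
  almost_complete_intersection I u v ->
  least_lcm_size u v s ->
  (forall i : nat, (i < s)%N -> betti I i = 'C(q.+1, i)) /\
  (forall i : nat, (s <= i <= q)%N ->
     betti I i = ('C(q.+1, q.+1 - i) - 'C(q.+1 - s, q.+1 - i))%N).
Proof.
move=> [gmin _ uCI] [s0 [J Js Jv] smin].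
have gA := minimal_monomial_generators_antichain gmin.
have [gU Ig _] := gmin.
have uA : {in u &, forall a b, (a <= b)%MM -> a = b}.
  by move=> a b au bu; apply: gA; rewrite mem_rcons inE ?au ?bu orbT.
have [uU vu] : uniq u /\ v \notin u by apply/andP; rewrite andbC -rcons_uniq.
have u0 : 0%MM \notin (u : seq _).
  apply: contra vu => u0; rewrite -(gA 0%MM v) //.
  - by rewrite mem_rcons inE u0 orbT.
  - by rewrite mem_rcons inE eqxx.
  - by apply/mnm_lepP => i; rewrite mnm0E.
have uC := complete_intersection_coprime uU uA u0 uCI.
have IP f : I f <-> {in msupp f, forall m, exists b, (generator u v b <= m)%MM}.
  rewrite Ig monomial_idealP; split=> H m /H.
    by case=> a /generator_mem [b ->] bm; exists b.
  by case=> b bm; exists (generator u v b) => //; apply/generator_mem; exists b.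
pose F := simplicial_resolution (join_complex0 Js s0) (@join_complex_sub _ J)
  (cone_apexP Jv) IP.
have Fmin : minimal_resolution F.
  exact/simplicial_minimal/(generator_label_neq gU gA uC Js s0 Jv smin).
have bettiE i : (i <= q.+1)%N ->
    betti I i = ('C(q.+1, i) - 'C(q.+1 - s, q.+1 - i))%N.
  move=> iq; rewrite -(card_faces Js) //; apply: (@minimal_betti _ _ _ _ _ F) => //.
    by move=> f h; rewrite !Ig; apply: ideal_generatedD.
  by move=> a f; rewrite !Ig; apply: ideal_generatedM.
have sq : (s <= q)%N by rewrite -Js -[leqRHS](card_ord q) max_card.
split=> i; last by case/andP=> _ iq; rewrite bettiE ?bin_sub // leqW.
move=> si; have iq : (i <= q)%N by apply: leq_trans sq; apply: ltnW.
rewrite bettiE ?(leqW iq) // (@bin_small (q.+1 - s)) ?subn0 //.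
by rewrite ltn_sub2l // ltnW.
Qed.
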